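(* Let $G$ be (the game form of) a 3-terminal Hex position. Then $G\equiv\top$ (i.e. $G$ has the connects-both property: Black can guarantee connecting all three black terminals within the region with White moving first) if and only if $G\mathbin{+_j} H^{\mathrm{op}}_n\equiv\top$ for all $n\geq 0$, where the dual simpleswitches are $H^{\mathrm{op}}_0=a$, $H^{\mathrm{op}}_1=\{a\mid a,\{b\mid\bot\}\}$ and $H^{\mathrm{op}}_{n+1}=\{H^{\mathrm{op}}_n\mid a,b\}$ for $n\geq1$.
   Context: A 3-terminal region of a Hex board is a set of cells completely surrounded by black and white stones (or board edges of the corresponding color) such that the surrounding black part has exactly three connected components, the terminals $1,2,3$, alternating with three white components; a 3-terminal Hex position is such a region with some cells possibly occupied. Outcome poset $P_3=\{\bot,a,b,c,\top\}$, $\bot<a,b,c<\top$, $a,b,c$ incomparable: in a full region the outcome is $\top$ if Black's stones connect all three terminals, $a$ if exactly $2,3$ are connected, $b$ if exactly $1,3$, $c$ if exactly $1,2$, $\bot$ if none. The game form of a position is atomic (its outcome) if the region is full, and otherwise $\{L\mid R\}$ where $L$ (resp. $R$) consists of the game forms after Black (resp. White) places a stone on an empty cell of the region. Game forms over a poset $A$: atomic $[x]$ (written $x$), $x\in A$, and composite $\{L\mid R\}$ with $L,R$ nonempty sets of game forms; atomic games have no options. $G^{(L)}$ is a left option if $G$ is composite and $G$ itself if atomic; similarly $G^{(R)}$. Mutually recursively: $G\leq H$ iff every $G^{(L)}\lhd H$ and $G\lhd H^{(R)}$ for every $H^{(R)}$; $G\lhd H$ iff some $G^R\leq H$, or $G\leq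 H^L$ for some $H^L$, or both are atomic $[x],[y]$ with $x\leq y$. $G\equiv H$ iff $G\leq H$ and $H\leq G$. Sum: for monotone $f:A\times B\to C$, $G+_fH=\{G^L+_fH,\,G+_fH^L\mid G^R+_fH,\,G+_fH^R\}$ if one of $G,H$ is composite, and $[x]+_f[y]=[f(x,y)]$. Juxtaposition $+_j$ is the sum with $f:P_3\times P_3\to\{\bot<\top\}$, where outcomes are viewed as equivalence relations on terminals ($\bot$ identity, $a$ identifies exactly $2,3$, $b$ exactly $1,3$, $c$ exactly $1,2$, $\top$ all): for $x$ on terminals $1_G,2_G,3_G$ and $y$ on $1_H,2_H,3_H$, take the equivalence generated by $x$, $y$, $1_G\sim 1_H$, $2_G\sim2_H$; $f(x,y)=\top$ iff $3_G\sim 3_H$, else $\bot$. *)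

(* Defs.v *)
From HB Require Import structures.
From mathcomp Require Import all_boot all_order.

Set Implicit Arguments.
Unset Strict Implicit.
Unset Printing Implicit Defensive.

Import Order.TTheory.

(** * Game forms over a poset *)

(* The nonempty sets of left and right options are given as families [L], [R]
   over index types [I], [J]; the points [i0], [j0] only witness
   nonemptiness. *)
Inductive game (A : Type) : Type :=
| Atom of A
| Comp (I J : Type) (i0 : I) (j0 : J) (L : I -> game A) (R : J -> game A).

Section GameOrder.
Context {d : Order.disp_t} {A : porderType d}.
Implicit Types G H : game A.

Definition lopt G G' : Prop :=
  if G is Comp _ _ _ _ L _ then exists i, G' = L i else False.
Definition ropt G G' : Prop :=
  if G is Comp _ _ _ _ _ R then exists j, G' = R j else False.

(* [loptA G G'] and [roptA G G']: G' is a $G^{(L)}$, resp. a $G^{(R)}$. *)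
Definition loptA G G' : Prop := if G is Atom _ then G' = G else lopt G G'.
Definition roptA G G' : Prop := if G is Atom _ then G' = G else ropt G G'.

(* The mutual recursion defining the two relations is well-founded, hence has
   exactly one solution: the inductively generated one. *)
Inductive gle : game A -> game A -> Prop :=
| GLe G H :
    (forall G', loptA G G' -> gltri G' H) ->
    (forall H', roptA H H' -> gltri G H') -> gle G H
with gltri : game A -> game A -> Prop :=
| GTriR G G' H : ropt G G' -> gle G' H -> gltri G H
| GTriL G H H' : lopt H H' -> gle G H' -> gltri G H
| GTriA (x y : A) : (x <= y)%O -> gltri (Atom x) (Atom y).

Definition gequiv G H : Prop := gle G H /\ gle H G.

End GameOrder.

Fixpoint gsum (A B C : Type) (f : A -> B -> C) (G : game A) :
    game B -> game C :=
  fix gsumG (H : game B) : game C :=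
    match G, H with
    | Atom x, Atom y => Atom (f x y)
    | Comp _ _ i0 j0 L R, Atom _ =>
        Comp i0 j0 (fun i => gsum f (L i) H) (fun j => gsum f (R j) H)
    | Atom _, Comp _ _ i0 j0 L R =>
        Comp i0 j0 (fun i => gsumG (L i)) (fun j => gsumG (R j))
    | Comp IG JG i0 j0 L R, Comp IH JH _ _ L' R' =>
        Comp (inl i0) (inl j0)
          (fun k : (IG + IH)%type => match k with
                             | inl i => gsum f (L i) H
                             | inr i => gsumG (L' i)
                             end)
          (fun k : (JG + JH)%type => match k with
                             | inl j => gsum f (R j) H
                             | inr j => gsumG (R' j)
                             end)
    end.

(* {L | R} and {L | R1, R2} *)
Definition game11 (A : Type) (L R : game A) : game A :=
  Comp tt tt (fun=> L) (fun=> R).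
Definition game12 (A : Type) (L R1 R2 : game A) : game A :=
  Comp tt true (fun=> L) (fun k : bool => if k then R1 else R2).

(** * The outcome poset *)

Inductive P3 : Type := Pbot | Pa | Pb | Pc | Ptop.

Definition P3_code (x : P3) : 'I_5 :=
  inord (match x with Pbot => 0 | Pa => 1 | Pb => 2 | Pc => 3 | Ptop => 4 end).
Definition P3_decode (k : 'I_5) : P3 := nth Pbot [:: Pbot; Pa; Pb; Pc; Ptop] k.
Lemma P3_codeK : cancel P3_code P3_decode.
Proof. by case; rewrite /P3_decode inordK. Qed.

HB.instance Definition _ := Finite.copy P3 (can_type P3_codeK).

Definition P3_le (x y : P3) : bool :=
  [|| x == y, x == Pbot | y == Ptop].

Lemma P3_eqE (x y : P3) : (x == y) =
  match x, y with
  | Pbot, Pbot | Pa, Pa | Pb, Pb | Pc, Pc | Ptop, Ptop => true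
  | _, _ => false
  end.
Proof. by apply/eqP/idP => [->|]; case: x y => [] []. Qed.

Lemma P3_le_refl : reflexive P3_le.
Proof. by move=> x; rewrite /P3_le eqxx. Qed.
Lemma P3_le_anti : antisymmetric P3_le.
Proof. by move=> x y; rewrite /P3_le !P3_eqE; case: x y => [] []. Qed.
Lemma P3_le_trans : transitive P3_le.
Proof. by move=> y x z; rewrite /P3_le !P3_eqE; case: x y z => [] [] []. Qed.

Fact P3_display : Order.disp_t. Proof. exact: Order.Disp tt tt. Qed.
HB.instance Definition _ := Order.Le_isPOrder.Build P3_display P3
  P3_le_refl P3_le_anti P3_le_trans.

(* Terminals 1, 2, 3. *)
Definition t1 : 'I_3 := @Ordinal 3 0 isT.
Definition t2 : 'I_3 := @Ordinal 3 1 isT.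
Definition t3 : 'I_3 := @Ordinal 3 2 isT.

Definition P3_rel (x : P3) (i j : 'I_3) : bool :=
  (i == j) ||
  match x with
  | Pbot => false
  | Pa => (i != t1) && (j != t1)
  | Pb => (i != t2) && (j != t2)
  | Pc => (i != t3) && (j != t3)
  | Ptop => true
  end.

(** * Juxtaposition *)

(* [inl] and [inr] are the terminals of the left and right summand.  The
   relation is symmetric, so [connect] below is the equivalence it generates. *)
Definition jglue (x y : P3) (s t : ('I_3 + 'I_3)%type) : bool :=
  match s, t with
  | inl i, inl j => P3_rel x i j
  | inr i, inr j => P3_rel y i j
  | inl i, inr j | inr i, inl j => (i == j) && (i != t3)
  end.

(* The poset {bot < top} is [bool], with [false < true]. *)
Definition jfun (x y : P3) : bool := connect (jglue x y) (inl t3) (inr t3).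

Lemma jfun_mono (x x' y y' : P3) :
  (x <= x')%O -> (y <= y')%O -> (jfun x y <= jfun x' y')%O.
Proof.
have P3_relS u u' i j : (u <= u')%O -> P3_rel u i j -> P3_rel u' i j.
  case/or3P => [/eqP->//|/eqP->|/eqP->]; rewrite /P3_rel ?orbT //.
  by rewrite orbF => ->.
move=> lex ley; suff: jfun x y -> jfun x' y' by case: jfun => // ->.
apply: (connect_sub (e := jglue x y)) => s t st; apply: connect1.
by case: s t st => i [] j //=; apply: P3_relS.
Qed.

Definition juxt : game P3 -> game P3 -> game bool := gsum jfun.

Fixpoint Hop (n : nat) : game P3 :=
  match n with
  | 0 => Atom Pa
  | n'.+1 =>
      if n' is 0
      then game12 (Atom Pa) (Atom Pa) (game11 (Atom Pb) (Atom Pbot))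
      else game12 (Hop n') (Atom Pa) (Atom Pb)
  end.

(** * Hex boards *)

Definition color := bool.
Notation Black := true (only parsing).
Notation White := false (only parsing).

Section Board.
Variables m n : nat.

Definition cell : finType := ('I_m * 'I_n)%type.

(* A side of the board is its color together with its position: low
   ([false]) or high ([true]) index.  The sides along the first and the last
   row are black, those along the first and the last column are white. *)
Definition side : finType := (color * bool)%type.
Definition site : finType := (cell + side)%type.

(* Coordinates are shifted by one, so that 0 is just off the board.  A point
   off the board both row- and columnwise is counted as black; the only such
   points next to a cell are at the two acute corners, where that single cell
   touches both sides anyway. *)
Definition locate (x y : nat) : site :=
  if x is x'.+1 then
    if insub x' is Some i then
      if y is y'.+1 then
        if insub y' is Some j then inl (i, j) else inr (White, true)
      else inr (White, false)
    else inr (Black, true)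
  else inr (Black, false).

(* The six directions in cyclic order, shifted by one: (0,1), (1,0), (1,-1),
   (0,-1), (-1,0), (-1,1). *)
Definition offset (d : 'I_6) : nat * nat :=
  nth (0, 0) [:: (1, 2); (2, 1); (2, 0); (1, 0); (0, 1); (0, 2)] d.

Definition neighbor (c : cell) (d : 'I_6) : site :=
  locate (c.1 + (offset d).1) (c.2 + (offset d).2).

Definition touches (s t : site) : bool :=
  if s is inl c then [exists d, neighbor c d == t] else false.
Definition adjacent (s t : site) : bool := touches s t || touches t s.

Definition induced (X : {set site}) (s t : site) : bool :=
  [&& s \in X, t \in X & adjacent s t].
Definition components (X : {set site}) : {set {set site}} :=
  equivalence_partition (connect (induced X)) X.

Definition stones := {ffun cell -> option color}.

Definition site_color (S : stones) (s : site) : option color :=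
  match s with inl c => S c | inr e => Some e.1 end.

(** * 3-terminal regions *)

Section Region.
Variable R : {set cell}.

Definition region_sites : {set site} := [set inl c | c in R].
Definition surround : {set site} :=
  [set s | (s \notin region_sites) &&
           [exists c in R, [exists d, neighbor c d == s]]].

(* A border dart (c, d) is the hexagon edge shared by the cell c of R and its
   neighbor in direction d, which is not in R.  The map [next_dart] walks
   along the boundary curve of R, each time turning around a common corner. *)
Definition border : {set cell * 'I_6} :=
  [set x | (x.1 \in R) && (neighbor x.1 x.2 \notin region_sites)].
Definition next_dart (x : cell * 'I_6) : cell * 'I_6 :=
  if neighbor x.1 (ordS x.2) is inl c then
    if c \in R then (c, ord_pred x.2) else (x.1, ordS x.2)
  else (x.1, ordS x.2).

Definition colored_surround (S : stones) (p : color) : {set site} :=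
  [set s in surround | site_color S s == Some p].

(* One walk around R meets all of its surroundings and passes exactly three
   times from black to white, hence three times from white to black: it
   consists of six arcs of alternating colors.  As there are three components
   of each color (see below), each component is one of these arcs. *)
Definition alternating (S : stones) : Prop :=
  (forall x y, x \in border -> y \in border -> fconnect next_dart x y) /\
  #|[set x in border |
      (site_color S (neighbor x.1 x.2) == Some Black) &&
      (site_color S (neighbor (next_dart x).1 (next_dart x).2)
         == Some White)]| = 3.

Record three_terminal (S : stones) (T : 'I_3 -> {set site}) : Prop := {
  surround_full : forall s, s \in surround -> site_color S s != None;
  terminal_inj : injective T;
  terminalE : [set T i | i : 'I_3] = components (colored_surround S Black);
  white_components : #|components (colored_surround S White)| = 3;
  surround_alternating : alternating S }.

End Region.

(** * 3-terminal positions and their game forms *)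

Section Play.
Variables (R : {set cell}) (T : 'I_3 -> {set site}).

Definition empties (S : stones) : {set cell} := [set c in R | S c == None].

Definition play (S : stones) (p : color) (c : cell) : stones :=
  [ffun c' => if c' == c then Some p else S c'].

Definition black_part (S : stones) : {set site} :=
  [set s in region_sites R :|: surround R | site_color S s == Some Black].

Definition linked (S : stones) (i j : 'I_3) : bool :=
  [exists s in T i, [exists t in T j, connect (induced (black_part S)) s t]].

Definition outcome (S : stones) : P3 :=
  if [&& linked S t1 t2, linked S t1 t3 & linked S t2 t3] then Ptop
  else if linked S t2 t3 then Pa
  else if linked S t1 t3 then Pb
  else if linked S t1 t2 then Pc
  else Pbot.

Lemma card_empties_play S p c :
  c \in empties S -> #|empties S| = #|empties (play S p c)|.+1.
Proof.
move=> Sc; rewrite (cardsD1 c) Sc add1n; congr _.+1; apply: eq_card => c'.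
by rewrite !inE ffunE; case: (c' == c); rewrite ?andbF.
Qed.

(* Structural recursion on [k], the number of empty cells of the region (see
   [card_empties_play]); the position is full exactly when [k] is 0. *)
Fixpoint form (k : nat) (S : stones) : game P3 :=
  match k, [pick c : {c | c \in empties S}] with
  | k'.+1, Some c0 =>
      Comp c0 c0 (fun c : {c | c \in empties S} => form k' (play S Black (val c)))
                 (fun c : {c | c \in empties S} => form k' (play S White (val c)))
  | _, _ => Atom (outcome S)
  end.

(* Black, moving second resp. first, can connect all three terminals. *)
Inductive wins_second : stones -> Prop :=
| WinsSecondFull S :
    empties S = set0 -> outcome S = Ptop -> wins_second S
| WinsSecondMove S :
    empties S != set0 ->
    (forall c, c \in empties S -> wins_first (play S White c)) -> wins_second S
with wins_first : stones -> Prop :=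
| WinsFirstFull S :
    empties S = set0 -> outcome S = Ptop -> wins_first S
| WinsFirstMove S c :
    c \in empties S -> wins_second (play S Black c) -> wins_first S.

End Play.

Record position3 : Type := Position3 {
  pos_stones : stones;
  pos_region : {set cell};
  pos_terminal : 'I_3 -> {set site};
  pos_three_terminal : three_terminal pos_region pos_stones pos_terminal }.

Definition game_form (P : position3) : game P3 :=
  form (pos_region P) (pos_terminal P)
    #|empties (pos_region P) (pos_stones P)| (pos_stones P).

Definition connects_both (P : position3) : Prop :=
  wins_second (pos_region P) (pos_terminal P) (pos_stones P).

End Board.

(* Main.v *)
Require Import Defs.
From mathcomp Require Import all_boot all_order.

(** No planarity is involved, only the fact that an extra black stone never
    hurts Black.  Black answers locally to carry a win from [G] to the
    juxtaposition.  Conversely, if White moving first can keep Black from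
    connecting all of [G], White does so in the sum with [Hop k] for large [k],
    treating every black move in [Hop k] as a pass.  Once [G] is filled with an
    outcome other than top, at least [Hop 2] remains, from which White still
    gets to pick whichever of [a], [b] is not below that outcome. *)

Set Implicit Arguments.
Unset Strict Implicit.
Unset Printing Implicit Defensive.

(** * Comparison with atomic game forms *)

Section AtomicBounds.
Context {d : Order.disp_t} {A : porderType d}.
Implicit Types G : game A.

Lemma gltri_AtomP (x : A) G :
  gltri (Atom x) G <->
  (exists2 y, G = Atom y & (x <= y)%O) \/
  (exists2 G', lopt G G' & gle (Atom x) G').
Proof.
split=> [xG|[[y -> xy]|[G' GG' xG']]]; last by apply: GTriL GG' xG'.
- inversion xG as [G0 G' H0 xG'|G0 H0 H' GG' xG'|x' y xy]; subst=> //.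
  + by right; exists H'.
  + by left; exists y.
- exact: GTriA.
Qed.

(** [Atom x] is its own left option, hence the first conjunct; an atomic [G] is its own right
    option, so that case is covered by the first conjunct too. *)
Lemma gle_AtomP (x : A) G :
  gle (Atom x) G <->
  gltri (Atom x) G /\ (forall G', ropt G G' -> gltri (Atom x) G').
Proof.
split=> [xG|[xG xG']]; last first.
  by constructor=> [_ ->|] //; case: G xG xG' => // y xy _ _ ->.
inversion xG as [G0 H0 xL xR]; subst; split; first exact: xL.
by case: G xR {xG xL}.
Qed.

Lemma gle_Atom_Atom (x y : A) : gle (Atom x) (Atom y) <-> (x <= y)%O.
Proof.
split=> [/gle_AtomP[/gltri_AtomP[[z [->]]|[]]]|xy] //.
by apply/gle_AtomP; split=> //; apply: GTriA.
Qed.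

Lemma gle_top (x : A) G : (forall y : A, y <= x)%O -> gle G (Atom x).
Proof.
move=> xmax; elim: G => [y|I J i0 j0 L IHL R IHR].
  exact/gle_Atom_Atom.
(* [Atom x] is its own right option. *)
have tri G : gle G (Atom x) -> gltri G (Atom x).
  by move=> Gx; inversion Gx as [G0 H0 _ xR]; apply: xR.
constructor=> [_ [i ->]|_ ->]; first exact: tri.
by apply: GTriR (IHR j0); exists j0.
Qed.

End AtomicBounds.

(** * Options of a sum *)

Section SumOptions.
Context {dA dB dC : Order.disp_t}.
Context {A : porderType dA} {B : porderType dB} {C : porderType dC}.
Variable f : A -> B -> C.
Implicit Types (G : game A) (H : game B).

Lemma lopt_gsum G H X :
  lopt (gsum f G H) X <->
  (exists2 G', lopt G G' & X = gsum f G' H) \/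
  (exists2 H', lopt H H' & X = gsum f G H').
Proof.
case: G H => [x|I J i0 j0 L R] [y|I' J' i0' j0' L' R'] /=; split.
all: try by [|case=> [] []].
- by case=> i ->; right; exists (L' i) => //; exists i.
- by case=> [[]//|[_ [i ->] ->]]; exists i.
- by case=> i ->; left; exists (L i) => //; exists i.
- by case=> [[_ [i ->] ->]|[]//]; exists i.
- case=> [[i ->|i ->]].
  + by left; exists (L i) => //; exists i.
  + by right; exists (L' i) => //; exists i.
- by case=> [[_ [i ->] ->]|[_ [i ->] ->]]; [exists (inl i)|exists (inr i)].
Qed.

Lemma ropt_gsum G H X :
  ropt (gsum f G H) X <->
  (exists2 G', ropt G G' & X = gsum f G' H) \/
  (exists2 H', ropt H H' & X = gsum f G H').
Proof.
case: G H => [x|I J i0 j0 L R] [y|I' J' i0' j0' L' R'] /=; split.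
all: try by [|case=> [] []].
- by case=> i ->; right; exists (R' i) => //; exists i.
- by case=> [[]//|[_ [i ->] ->]]; exists i.
- by case=> i ->; left; exists (R i) => //; exists i.
- by case=> [[_ [i ->] ->]|[]//]; exists i.
- case=> [[i ->|i ->]].
  + by left; exists (R i) => //; exists i.
  + by right; exists (R' i) => //; exists i.
- by case=> [[_ [i ->] ->]|[_ [i ->] ->]]; [exists (inl i)|exists (inr i)].
Qed.

Lemma gsum_Atom G H z :
  gsum f G H = Atom z ->
  exists x y, [/\ G = Atom x, H = Atom y & z = f x y].
Proof.
by case: G H => [x|I J i0 j0 L R] [y|I' J' i0' j0' L' R'] //= [<-]; exists x, y.
Qed.

End SumOptions.

(** * The top outcome and juxtaposition of outcomes *)

Lemma P3_le_top (x : P3) : (x <= Ptop)%O.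
Proof. by rewrite /Order.le /= /P3_le eqxx !orbT. Qed.

Lemma P3_top_le (x : P3) : (Ptop <= x)%O -> x = Ptop.
Proof. by rewrite /Order.le /= /P3_le !P3_eqE; case: x. Qed.

Lemma connect_invariant (U : finType) (e : rel U) (p : pred U) x y :
  (forall s t, e s t -> p s -> p t) -> connect e x y -> p x -> p y.
Proof.
move=> ep /connectP[q + ->]; elim: q x => //= z q IH x /andP[xz /IH pz] px.
exact: pz (ep _ _ xz px).
Qed.

(** The path runs through terminal 2 of both summands; for [Pb] below it runs through terminal 1. *)
Lemma jfun_top_a : jfun Ptop Pa.
Proof.
apply: connect_trans (connect1 (_ : jglue _ _ _ (inl t2))) _ => //.
by apply: connect_trans (connect1 (_ : jglue _ _ _ (inr t2))) (connect1 _).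
Qed.

Lemma jfun_top_b : jfun Ptop Pb.
Proof.
apply: connect_trans (connect1 (_ : jglue _ _ _ (inl t1))) _ => //.
by apply: connect_trans (connect1 (_ : jglue _ _ _ (inr t1))) (connect1 _).
Qed.

(** Against [Pa], [x] has to join 3 to 2; against [Pb], it has to join 3 to 1. Only [Ptop] does
    both. *)
Lemma jfun_ab_top x : jfun x Pa -> jfun x Pb -> x = Ptop.
Proof.
(* The class of [inl t3] under [x], carried across the glued terminals. It omits [inr t3], so its
   closure under [jglue] refutes the connection. *)
pose reach (s : 'I_3 + 'I_3) :=
  match s with inl j => P3_rel x t3 j | inr j => P3_rel x t3 j && (j != t3) end.
have noconn y :
    (forall s t, jglue x y s t -> reach s -> reach t) -> ~ jfun x y.
  by move=> inv xy; have := connect_invariant inv xy=> /(_ isT).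
move=> xa xb; apply/eqP; apply: contraT => xt.
(* [Pa] does not join 3 to 1 and fails against [Pb]; the other values below top do not join 3 to 2
   and fail against [Pa]. *)
have [xE|xNa] := eqVneq x Pa.
  case: (noconn Pb _ xb); rewrite /reach xE.
  by move=> [] [[|[|[|?]]] ?] [] [[|[|[|?]]] ?].
case: (noconn Pa _ xa).
by move=> [] [[|[|[|?]]] ?] [] [[|[|[|?]]] ?] //; rewrite /reach /jglue /P3_rel;
   move: xNa xt; rewrite !P3_eqE; case: (x).
Qed.

(** * Moves in the game form of a region *)

Section Moves.
Variables (m n : nat) (R : {set cell m n}) (T : 'I_3 -> {set site m n}).
Implicit Types S : stones m n.

Definition gform S : game P3 := form R T #|empties R S| S.

Lemma form_full S : empties R S = set0 -> gform S = Atom (outcome R T S).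
Proof. by rewrite /gform => ->; rewrite cards0. Qed.

Lemma form_options S : empties R S != set0 ->
  (forall X, lopt (gform S) X <->
     exists2 c, c \in empties R S & X = gform (play S Black c)) /\
  (forall X, ropt (gform S) X <->
     exists2 c, c \in empties R S & X = gform (play S White c)).
Proof.
case/set0Pn=> c0 Sc0; rewrite /gform (card_empties_play Black Sc0) /=.
case: pickP => [u0 _|/(_ (Sub c0 Sc0))//] /=.
(* The recursion depth was unfolded using [c0]; every move leaves equally many empty cells, so the
   depth is right for each option. *)
have cardE p c : c \in empties R S ->
    #|empties R (play S Black c0)| = #|empties R (play S p c)|.
  by move=> Sc; apply/eq_add_S; rewrite -!card_empties_play.
split=> X; split=> [[[c Sc] ->]|[c Sc ->]].
- by exists c; rewrite // -(cardE true c).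
- by exists (exist _ c Sc); rewrite -(cardE true c).
- by exists c; rewrite // -(cardE false c).
- by exists (exist _ c Sc); rewrite -(cardE false c).
Qed.

Lemma lopt_form S X : lopt (gform S) X <->
  exists2 c, c \in empties R S & X = gform (play S Black c).
Proof.
have [S0|/form_options[]//] := eqVneq (empties R S) set0.
by rewrite form_full // S0; split=> // -[c]; rewrite inE.
Qed.

Lemma ropt_form S X : ropt (gform S) X <->
  exists2 c, c \in empties R S & X = gform (play S White c).
Proof.
have [S0|/form_options[]//] := eqVneq (empties R S) set0.
by rewrite form_full // S0; split=> // -[c]; rewrite inE.
Qed.

Lemma form_Atom S x :
  gform S = Atom x -> empties R S = set0 /\ x = outcome R T S.
Proof.
have [S0|/set0Pn[c Sc] SA] := eqVneq (empties R S) set0.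
  by rewrite form_full // => -[].
have /lopt_form : exists2 c', c' \in empties R S &
    gform (play S Black c) = gform (play S Black c') by exists c.
by rewrite SA.
Qed.

Lemma play_ind (Q : stones m n -> Prop) :
  (forall S, (forall p c, c \in empties R S -> Q (play S p c)) -> Q S) ->
  forall S, Q S.
Proof.
move=> QS S; have [k] := ubnP #|empties R S|; elim: k => // k IHk in S *.
rewrite ltnS => Sk; apply: QS => p c Sc; apply: IHk.
by rewrite -(card_empties_play p Sc).
Qed.

(** * Extra black stones and winning strategies *)

(** White stones may turn black too, so the relation survives a white move in [S] on a cell already
    black in [S'] ([darker_filled]). *)
Definition darker S S' : Prop := forall c, S' c = Some Black \/ S' c = S c.

Lemma darker_play S S' p c :
  darker S S' -> darker (play S p c) (play S' p c).
Proof. by move=> SS' c'; rewrite !ffunE; case: eqP => // _; right. Qed.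

Lemma darker_filled S S' p c :
  darker S S' -> c \in empties R S -> c \notin empties R S' ->
  darker (play S p c) S'.
Proof.
move=> SS'; rewrite !inE => /andP[-> /eqP Sc] S'c c'; rewrite ffunE.
have [->|_] := eqVneq c' c; last exact: SS'.
by case: (SS' c) S'c => ->; [left|rewrite Sc].
Qed.

Lemma empties_darker S S' c :
  darker S S' -> c \in empties R S' -> c \in empties R S.
Proof.
by move=> /(_ c) SS'; rewrite !inE; case: SS' => -> //; rewrite andbF.
Qed.

Lemma full_darker S S' :
  darker S S' -> empties R S = set0 -> empties R S' = set0.
Proof.
move=> SS' S0; apply/setP => c; rewrite [RHS]inE.
by apply/negP => /(empties_darker SS'); rewrite S0 inE.
Qed.

Lemma linked_darker S S' i j :
  darker S S' -> linked R T S i j -> linked R T S' i j.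
Proof.
move=> SS' /existsP[s /andP[Ts /existsP[t /andP[Tt st]]]].
apply/existsP; exists s; rewrite Ts; apply/existsP; exists t; rewrite Tt /=.
have sub u : u \in black_part R S -> u \in black_part R S'.
  rewrite [u \in black_part R S]inE [u \in black_part R S']inE.
  by case/andP=> -> /=; case: u => [c|e] //=; case: (SS' c) => ->.
apply: connect_sub st => u v /and3P[/sub Su /sub Sv uv].
by apply: connect1; rewrite /induced Su Sv.
Qed.

Lemma outcome_darker S S' :
  darker S S' -> outcome R T S = Ptop -> outcome R T S' = Ptop.
Proof.
move=> SS'; rewrite {1}/outcome.
case: ifP => [/and3P[l12 l13 l23] _|_]; last by do 3?case: ifP.
by rewrite /outcome !(linked_darker SS').
Qed.

Lemma wins_secondP S : wins_second R T S <->
  (empties R S = set0 -> outcome R T S = Ptop) /\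
  (forall c, c \in empties R S -> wins_first R T (play S White c)).
Proof.
split=> [[{}S S0 St|{}S SN0 Sw]|[St Sw]].
- by split=> // c; rewrite S0 inE.
- by split=> // S0; rewrite S0 eqxx in SN0.
- have [S0|SN0] := eqVneq (empties R S) set0.
    exact: WinsSecondFull S0 (St S0).
  exact: WinsSecondMove.
Qed.

Lemma wins_firstP S : wins_first R T S <->
  (empties R S = set0 /\ outcome R T S = Ptop) \/
  (exists2 c, c \in empties R S & wins_second R T (play S Black c)).
Proof.
split=> [[{}S S0 St|{}S c Sc Sw]|[[S0 St]|[c Sc Sw]]].
- by left.
- by right; exists c.
- exact: WinsFirstFull.
- exact: WinsFirstMove Sw.
Qed.

(* The three claims need a joint induction: a cell that is to be played in [S]
   may already be black in [S'], and skipping that move passes the turn. *)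
Lemma wins_darker S : forall S', darker S S' ->
  [/\ wins_first R T S -> wins_first R T S',
      wins_second R T S -> wins_second R T S' &
      wins_second R T S -> wins_first R T S'].
Proof.
elim/play_ind: S => S IH S' SS'.
(* White is made to spend a move in [S] on the cell [c], which is black in [S'']; then Black is to
   move. *)
have filled S'' c : darker S S'' -> c \in empties R S ->
    c \notin empties R S'' -> wins_second R T S -> wins_first R T S''.
  move=> SS'' Sc S''c /wins_secondP[_ /(_ c Sc)].
  by have [] := IH White c Sc S'' (darker_filled _ SS'' Sc S''c).
have second S'' : darker S S'' -> wins_second R T S -> wins_second R T S''.
  move=> SS'' Sw; have [St Sw'] := (wins_secondP S).1 Sw.
  apply/wins_secondP; split=> [S''0|c S''c].
    have [S0|/set0Pn[c Sc]] := eqVneq (empties R S) set0.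
      exact: outcome_darker SS'' (St S0).
    have S''c : c \notin empties R S'' by rewrite S''0 inE.
    have /wins_firstP[[]//|[c']] := filled S'' c SS'' Sc S''c Sw.
    by rewrite S''0 inE.
  have Sc := empties_darker SS'' S''c.
  by have [/(_ (Sw' c Sc))] := IH White c Sc _ (darker_play White c SS'').
split=> [|Sw|Sw]; last 1 first.
- have [S'0|/set0Pn[c S'c]] := eqVneq (empties R S') set0.
    have /wins_secondP[/(_ S'0) S't _] := second S' SS' Sw.
    exact: WinsFirstFull.
  (* A black stone on any empty cell keeps the position darker than [S], so it serves as a pass. *)
  apply: (WinsFirstMove S'c); apply: second Sw => c'.
  by rewrite ffunE; case: eqP => _; [left|exact: SS'].
- case/wins_firstP => [[S0 St]|[c Sc Sw]].
    exact: WinsFirstFull (full_darker SS' S0) (outcome_darker SS' St).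
  have [S'c|S'c] := boolP (c \in empties R S').
    apply: (WinsFirstMove S'c).
    by have [_ /(_ Sw)] := IH Black c Sc _ (darker_play Black c SS').
  by have [_ _ /(_ Sw)] := IH Black c Sc _ (darker_filled _ SS' Sc S'c).
- exact: second.
Qed.

Lemma wins_second_first S : wins_second R T S -> wins_first R T S.
Proof. by have [] := @wins_darker S S (fun=> or_intror erefl). Qed.

(** The bounds by [Ptop] unfold to the clauses of the two winning predicates, except that [gle] also
    demands [gltri]; [wins_second_first] supplies this. *)
Lemma form_top S :
  (gle (Atom Ptop) (gform S) <-> wins_second R T S) /\
  (gltri (Atom Ptop) (gform S) <-> wins_first R T S).
Proof.
elim/play_ind: S => S IH.
have first : gltri (Atom Ptop) (gform S) <-> wins_first R T S.
  split.
    case/gltri_AtomP => [[x /form_Atom[S0 ->] /P3_top_le St]|].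
      exact: WinsFirstFull.
    case=> _ /lopt_form[c Sc ->] /(IH Black c Sc).1; exact: WinsFirstMove.
  case/wins_firstP=> [[S0 St]|[c Sc Sw]].
    by rewrite form_full // St; apply: GTriA.
  apply/gltri_AtomP; right; exists (gform (play S Black c)).
    by apply/lopt_form; exists c.
  exact/(IH Black c Sc).1.
split=> //; split.
  case/gle_AtomP => [/first Sf SR]; apply/wins_secondP; split=> [S0|c Sc].
    by case/wins_firstP: Sf => [[]//|[c]]; rewrite S0 inE.
  by apply/(IH White c Sc).2/SR/ropt_form; exists c.
move=> Sw; apply/gle_AtomP; split; first exact/first/wins_second_first.
move=> _ /ropt_form[c Sc ->]; apply/(IH White c Sc).2.
exact: ((wins_secondP S).1 Sw).2.
Qed.

(** * From a win in the region to a win in the juxtaposition *)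

Definition preserves_wins (K : game P3) : Prop := forall S,
  (wins_second R T S -> gle (Atom true) (juxt (gform S) K)) /\
  (wins_first R T S -> gltri (Atom true) (juxt (gform S) K)).

(* If [K] is composite, Black needs a safe move in it in case [S] is full. *)
Lemma preserves_wins_step K :
  (exists2 x, K = Atom x & jfun Ptop x) \/
  (exists2 K', lopt K K' & preserves_wins K') ->
  (forall K', ropt K K' -> forall S, wins_second R T S ->
     gltri (Atom true) (juxt (gform S) K')) ->
  preserves_wins K.
Proof.
move=> Kwait KR; apply: play_ind => S IH.
have first : wins_first R T S -> gltri (Atom true) (juxt (gform S) K).
  case/wins_firstP=> [[S0 St]|[c Sc Sw]].
    case: Kwait => [[x -> fx]|[K' KK' K'w]].
      by rewrite form_full // St /juxt /= fx; apply: GTriA.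
    apply: (GTriL (H' := juxt (gform S) K')).
      by apply/lopt_gsum; right; exists K'.
    by apply: (K'w S).1; apply: WinsSecondFull.
  apply: (GTriL (H' := juxt (gform (play S Black c)) K)).
    apply/lopt_gsum; left; exists (gform (play S Black c)) => //.
    by apply/lopt_form; exists c.
  exact: (IH Black c Sc).1.
split=> // Sw; apply/gle_AtomP; split; first exact/first/wins_second_first.
move=> _ /ropt_gsum[[_ /ropt_form[c Sc ->] ->]|[K' KK' ->]]; last exact: KR.
by apply: (IH White c Sc).2; apply: ((wins_secondP S).1 Sw).2.
Qed.

Lemma preserves_wins_first K S :
  preserves_wins K -> wins_second R T S -> gltri (Atom true) (juxt (gform S) K).
Proof. by move=> Kw /wins_second_first /(Kw S).2. Qed.

Lemma preserves_wins_Atom x : jfun Ptop x -> preserves_wins (Atom x).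
Proof. by move=> fx; apply: preserves_wins_step => //; left; exists x. Qed.

(** The safe black move is to the preceding [Hop]. After a white move in [Hop k] Black is to move in
    a sum whose region is won even moving second. *)
Lemma preserves_wins_Hop k : preserves_wins (Hop k).
Proof.
have wa := preserves_wins_Atom jfun_top_a.
have wb := preserves_wins_Atom jfun_top_b.
elim: k => [|[|k] IHk] //; apply: preserves_wins_step.
- by right; exists (Atom Pa) => //; exists tt.
- move=> _ [[] ->] S Sw /=; first exact: preserves_wins_first.
  (* White's threat [{b | bot}] is answered at once by moving to [b]. *)
  apply: (GTriL (H' := juxt (gform S) (Atom Pb))); last exact: (wb S).1.
  by apply/lopt_gsum; right; exists (Atom Pb) => //; exists tt.
- by right; exists (Hop k.+1) => //; exists tt.
- by move=> _ [[] ->] S Sw /=; apply: preserves_wins_first.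
Qed.

(** * From the juxtaposition back to the region *)

Lemma gltri_juxt_Atom S x :
  empties R S = set0 -> gltri (Atom true) (juxt (gform S) (Atom x)) ->
  jfun (outcome R T S) x.
Proof.
move=> S0; rewrite form_full // => /gltri_AtomP[[y [->]]|[]] //.
by case: y.
Qed.

(** White may move to [Pa] or to [Pb], and either move fills the sum, leaving Black no reply. The
    index is at least 2 because [Hop 1] has no right option [Pb]. *)
Lemma juxt_Hop_full S k :
  empties R S = set0 -> gle (Atom true) (juxt (gform S) (Hop k.+2)) ->
  outcome R T S = Ptop.
Proof.
move=> S0 /gle_AtomP[_ SR]; apply: jfun_ab_top;
  apply: gltri_juxt_Atom => //; apply: SR; apply/ropt_gsum; right.
- by exists (Atom Pa) => //; exists true.
- by exists (Atom Pb) => //; exists false.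
Qed.

(** Each white move in [S] fills a cell and so pays for one black move in [Hop], which lowers the
    index by one. Hence the index stays at least two above the number of empty cells whenever White
    is to move. *)
Lemma juxt_Hop_wins S : forall k, #|empties R S| <= k ->
  (gle (Atom true) (juxt (gform S) (Hop k.+2)) -> wins_second R T S) /\
  (gltri (Atom true) (juxt (gform S) (Hop k.+3)) -> wins_first R T S).
Proof.
elim/play_ind: S => S IH.
have second k : #|empties R S| <= k ->
    gle (Atom true) (juxt (gform S) (Hop k.+2)) -> wins_second R T S.
  move=> Sk SH; apply/wins_secondP; split=> [S0|c Sc].
    exact: juxt_Hop_full S0 SH.
  rewrite (card_empties_play White Sc) in Sk.
  (* [c] is empty, so [k] is positive; in terms of its predecessor the switch is [Hop k.+3], as the
     second claim requires. *)
  case: k Sk SH => // k Sk /gle_AtomP[_ SR].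
  apply: (IH White c Sc k Sk).2; apply: SR; apply/ropt_gsum; left.
  by exists (gform (play S White c)) => //; apply/ropt_form; exists c.
move=> k Sk; split; first exact: second.
case/gltri_AtomP=> [[x /gsum_Atom[y [z []]]]|] //.
case=> _ /lopt_gsum[[_ /lopt_form[c Sc ->] ->] SH|[_ [i ->] ->] /= SH].
  apply: (WinsFirstMove Sc); apply: (IH Black c Sc k.+1 _).1 SH.
  by rewrite -ltnS -(card_empties_play Black Sc) !leqW.
(* Black moved to [Hop k.+2], which is a pass in [S]. *)
exact/wins_second_first/second/SH.
Qed.

End Moves.

Theorem theorem4p7 (m n : nat) (P : position3 m n) :
  (connects_both P <-> gequiv (game_form P) (Atom Ptop)) /\
  (gequiv (game_form P) (Atom Ptop) <->
   forall k : nat, gequiv (juxt (game_form P) (Hop k)) (Atom true)).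
Proof.
set R := pos_region P; set T := pos_terminal P; set S := pos_stones P.
have winsE : connects_both P <-> gequiv (game_form P) (Atom Ptop).
  split=> [wS|[_ Gt]]; last exact/(form_top R T S).1.
  by split; [apply/gle_top/P3_le_top | apply/(form_top R T S).1].
split=> //; split=> [/winsE wS k|eqH].
  split; first by apply: gle_top; case.
  exact: (preserves_wins_Hop R T k S).1.
(* A single index suffices: one for each empty cell, plus two for the final choice between [a] and
   [b]. *)
apply/winsE; have [_ SH] := eqH #|empties R S|.+2.
exact: (juxt_Hop_wins T (leqnn #|empties R S|)).1 SH.
Qed.
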